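(* Let $m,m_0$ be nonnegative integers, let $G$ be a graph, and let $f:V(G)\rightarrow \mathbb{Z}_2$ be a mapping with $\sum_{v\in V(G)}f(v) \equiv 0 \pmod 2$. If $G$ is $(2m+2m_0+2)$-edge-connected, then $G$ has an $m$-tree-connected factor $H$ with $d_H(v)\equiv f(v)\pmod 2$ for every vertex $v$, such that $G\setminus E(H)$ is $m_0$-tree-connected and for each vertex $v$, $$\left\lfloor \frac{d_{G}(v)}{2}\right\rfloor-1-m_0\le d_H(v)\le \left\lceil \frac{d_{G}(v)}{2}\right\rceil+1+m.$$ Furthermore, for an arbitrary given vertex $z$ and any integer $t$ with $t\equiv f(z)\pmod 2$ and $\lfloor d_G(z)/2\rfloor-1-m_0\le t\le \lceil d_G(z)/2\rceil+1+m$, $H$ can be chosen so that additionally $d_H(z)=t$.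
   Context: Graphs may have loops and multiple edges. A factor is a spanning subgraph. A graph is $m$-tree-connected if it contains $m$ edge-disjoint spanning trees. *)

(* Defs.v *)
From HB Require Import structures.
From mathcomp Require Import all_boot all_order all_algebra.

Set Implicit Arguments.
Unset Strict Implicit.
Unset Printing Implicit Defensive.

(* Finite undirected graphs with loops and multiple edges.  The order of the
   two ends of an edge carries no meaning: it is only used through [joins] and
   [deg], which are symmetric in the two ends. *)
Record mgraph := MGraph {
  vert : finType;
  edge : finType;
  ends : edge -> vert * vert
}.

(* A factor (spanning subgraph) is given by its edge set F : {set edge G}; G
   itself is [set: edge G], and deleting the edges of F from G gives ~: F. *)

Section Factors.

Variable G : mgraph.
Implicit Types (F : {set edge G}) (e : edge G) (u v : vert G).

Definition joins e u v : bool := (ends e == (u, v)) || (ends e == (v, u)).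

(* A loop counts twice. *)
Definition deg F v : nat :=
  \sum_(e in F) (((ends e).1 == v) + ((ends e).2 == v)).

Definition adj F : rel (vert G) := [rel u v | [exists e in F, joins e u v]].

Definition connected_factor F : Prop :=
  0 < #|vert G| /\ forall u v, connect (adj F) u v.

(* A cycle of length k.+1: distinct vertices v_0, ..., v_k and distinct edges
   e_0, ..., e_k, with e_i joining v_i to v_(i+1), indices modulo k.+1.
   Length 1 is a loop and length 2 is a pair of parallel edges. *)
Definition has_cycle F : Prop :=
  exists (k : nat) (v : 'I_k.+1 -> vert G) (e : 'I_k.+1 -> edge G),
    [/\ injective v, injective e &
        forall i, e i \in F /\ joins (e i) (v i) (v (ordS i))].

Definition spanning_tree F : Prop := connected_factor F /\ ~ has_cycle F.

Definition tree_connected (m : nat) F : Prop :=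
  exists T : 'I_m -> {set edge G},
    [/\ forall i, T i \subset F,
        forall i, spanning_tree (T i) &
        forall i j, i != j -> [disjoint T i & T j]].

(* As usual, a graph with a single vertex is not k-edge-connected. *)
Definition edge_connected (k : nat) : Prop :=
  1 < #|vert G| /\
  forall F, #|F| < k -> connected_factor (~: F).

End Factors.

Arguments edge_connected : clear implicits.

Import GRing.Theory Num.Theory.
Local Open Scope ring_scope.

Definition parity_factor (m m0 : nat) (G : mgraph) (f : vert G -> 'Z_2)
    (H : {set edge G}) : Prop :=
  [/\ tree_connected m H,
      forall v, (deg H v)%:R = f v,
      tree_connected m0 (~: H) &
      forall v,
        ((deg [set: edge G] v)./2)%:Z - 1 - m0%:Z <= (deg H v)%:Z
          <= (uphalf (deg [set: edge G] v))%:Z + 1 + m%:Z].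

(* Main.v *)
Require Import Defs.
From HB Require Import structures.
From mathcomp Require Import all_boot all_order all_algebra.
From mathcomp Require Import zify.

(* Put k = m + m0 + 1, so that every cut has at least 2k edges.  Orient G so that in- and
   out-degrees differ by at most one away from z, the root z has in-degree at least its
   out-degree, and every nonempty vertex set avoiding z is entered by k arcs.  Edmonds' theorem
   gives k arc-disjoint branchings from z: m of them, T, go into H, m0 of them, T0, stay out of H,
   and one, T1, is kept for parities.  At each vertex v, pair floor(d(v)/2) - k arcs entering v
   outside T, T0 and T1 with distinct arcs leaving v, and ask that exactly one arc of each pair
   belong to H; since v has m entering arcs in T and m0 in T0, this alone forces the degree bounds.
   Pairing an entering arc i with a leaving arc o amounts to splitting them off into a single arc
   from the tail of i to the head of o.  Of two candidates for o, at least one keeps T1 a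
   branching: i has to differ from o, and the tail of i must not be a T1-descendant of the head of
   o.  Once all pairs are split off, T1 serves to correct the parities at all vertices but z.  At z
   all leaving arcs outside T and T0 but one are paired, the remaining entering arcs are coloured
   freely so as to reach the degree t up to one unit, and the handshake lemma gives its parity. *)

Set Implicit Arguments.
Unset Strict Implicit.
Unset Printing Implicit Defensive.

(** * Balanced rooted orientations *)

Section Orientation.

Variables (V E : finType) (en : E -> V * V).
Implicit Types (X Y : {set V}) (F : {set E}) (v : V) (e : E).

Definition inside F X : nat :=
  \sum_(e in F) (((en e).1 \in X) && ((en e).2 \in X)).
Definition cut X : nat := \sum_e (((en e).1 \in X) (+) ((en e).2 \in X)).
Definition edeg v : nat := \sum_e (((en e).1 == v) + ((en e).2 == v)).

Lemma sum_pred1 (A : {set V}) (x : V) : \sum_(v in A) (x == v : nat) = (x \in A).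
Proof.
case: (boolP (x \in A)) => xA.
  rewrite (bigD1 x) //= eqxx big1 // => v /andP[_ /negbTE].
  by rewrite eq_sym => ->.
rewrite big1 // => v vA; case: eqP => // xv; by rewrite xv vA in xA.
Qed.

Lemma insideT X :
  inside setT X = \sum_e (((en e).1 \in X) && ((en e).2 \in X)).
Proof. by apply: eq_bigl => e; rewrite inE. Qed.

Lemma sum_edeg X : \sum_(v in X) edeg v = 2 * inside setT X + cut X.
Proof.
rewrite /edeg exchange_big /= insideT /cut.
rewrite big_distrr -big_split; apply: eq_bigr => e _ /=.
by rewrite big_split /= !sum_pred1; case: (_ \in X); case: (_ \in X).
Qed.

Lemma inside_setU F X Y :
  inside F X + inside F Y <= inside F (X :|: Y) + inside F (X :&: Y).
Proof.
rewrite /inside -!big_split; apply: leq_sum => e _ /=; rewrite !inE.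
by case: (_ \in X); case: (_ \in X); case: (_ \in Y); case: (_ \in Y).
Qed.

Lemma sum_setUI (mu : V -> nat) X Y :
  \sum_(v in X :|: Y) mu v + \sum_(v in X :&: Y) mu v =
  \sum_(v in X) mu v + \sum_(v in Y) mu v.
Proof.
rewrite !(big_mkcond (fun v => v \in _)) -!big_split; apply: eq_bigr => v _ /=.
by rewrite !inE; case: (v \in X); case: (v \in Y); rewrite /= ?addn0 ?add0n.
Qed.

(** * Orientations with bounded in-degrees *)

Definition head_of (b : E -> bool) e := if b e then (en e).1 else (en e).2.
Definition tail_of (b : E -> bool) e := if b e then (en e).2 else (en e).1.

(** Hakimi's criterion, by induction on the edges: remove one, orient it towards one of its ends and
    lower [mu] there by one. Only a tight set containing this end but not the other forbids it. *)
Lemma orientation_le_indegree F (mu : V -> nat) :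
  (forall X, inside F X <= \sum_(v in X) mu v) ->
  exists b, forall v, \sum_(e in F) (head_of b e == v) <= mu v.
Proof.
elim: {F}#|F| {-2}F (erefl #|F|) mu => [|n IH] F cF mu hmu.
  exists xpredT => v; rewrite big_pred0 // => e.
  by move/eqP: cF; rewrite cards_eq0 => /eqP ->; rewrite inE.
have /card_gt0P[e eF] : 0 < #|F| by rewrite cF.
have cF' : #|F :\ e| = n by move: cF; rewrite (cardsD1 e) eF => -[].
have insD X : inside F X = (((en e).1 \in X) && ((en e).2 \in X)) + inside (F :\ e) X.
  rewrite /inside (bigD1 e) //=; congr addn; apply: eq_bigl => e'.
  by rewrite !inE andbC.
pose dec (a : V) v := mu v - (v == a).
have sumdec a X : \sum_(v in X) mu v <= \sum_(v in X) dec a v + (a \in X).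
  rewrite -sum_pred1 -big_split; apply: leq_sum => v _ /=; rewrite /dec eq_sym; lia.
have step a b0 (bb : bool) : (forall b : E -> bool, b e = bb -> head_of b e = a) ->
    [set a; b0] = [set (en e).1; (en e).2] ->
    (forall X, a \in X -> b0 \notin X -> inside F X < \sum_(v in X) mu v) ->
    exists b, forall v, \sum_(e in F) (head_of b e == v) <= mu v.
  move=> ha eab ntight.
  have both X : (((en e).1 \in X) && ((en e).2 \in X)) = ((a \in X) && (b0 \in X)).
    have E1 : ([set (en e).1; (en e).2] \subset X) = ([set a; b0] \subset X) by rewrite eab.
    by move: E1; rewrite !subUset !sub1set.
  have mua : 0 < mu a.
    case: (eqVneq a b0) => [ab|ab].
      have := hmu [set a]; rewrite insD both -ab !inE eqxx /= big_set1; lia.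
    have := ntight [set a]; rewrite !inE eqxx (eq_sym b0) ab big_set1 => /(_ isT isT); lia.
  have [X|b hb] := IH _ cF' (dec a).
    have := hmu X; have := sumdec a X; have := ntight X; rewrite insD both.
    case: (a \in X) => /=; case: (b0 \in X) => /= ?; lia.
  exists (fun e' => if e' == e then bb else b e') => v.
  rewrite (bigD1 e) //= {1}ha ?eqxx //.
  rewrite (eq_bigl (fun e' => e' \in F :\ e)); last by move=> e'; rewrite !inE andbC.
  rewrite (eq_bigr (fun e' => (head_of b e' == v) : nat)); last first.
    by move=> e'; rewrite !inE /head_of => /andP[/negbTE ->].
  have := hb v; rewrite /dec (eq_sym a).
  by case: eqP => [->|_] /=; lia.
pose tightab (a b0 : V) :=
  [exists X : {set V}, [&& a \in X, b0 \notin X & inside F X == \sum_(v in X) mu v]].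
have ntight a b0 : ~~ tightab a b0 ->
    forall X, a \in X -> b0 \notin X -> inside F X < \sum_(v in X) mu v.
  move=> /existsPn h X aX bX; have := h X; rewrite aX bX /= => h'.
  by rewrite ltn_neqAle h' hmu.
case: (boolP (tightab (en e).1 (en e).2)) => [/existsP[X /and3P[aX bX /eqP tX]]|h1]; last first.
  apply: (step (en e).1 (en e).2 true) => //; last exact: ntight.
  by move=> b; rewrite /head_of => ->.
case: (boolP (tightab (en e).2 (en e).1)) => [/existsP[Y /and3P[bY aY /eqP tY]]|h2]; last first.
  apply: (step (en e).2 (en e).1 false) => //; last exact: ntight.
    by move=> b; rewrite /head_of => ->.
  by rewrite setUC.
(* Both directions are blocked: [e] lies inside [X :|: Y] but in neither [X] nor [Y], so
   supermodularity on the remaining edges contradicts tightness. *)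
have := inside_setU (F :\ e) X Y; have := hmu (X :|: Y); have := hmu (X :&: Y).
have := sum_setUI mu X Y; rewrite -tX -tY !insD !inE aX bY (negbTE aY) (negbTE bX) /= ?orbT /=; lia.
Qed.

Definition arc_in (b : E -> bool) X : nat :=
  \sum_e ((head_of b e \in X) && (tail_of b e \notin X)).

Lemma sum_head b X :
  \sum_(v in X) \sum_e (head_of b e == v) = inside setT X + arc_in b X.
Proof.
rewrite exchange_big /= insideT /arc_in.
rewrite -big_split; apply: eq_bigr => e _ /=; rewrite sum_pred1 /head_of /tail_of.
by case: (b e); case: (_ \in X); case: (_ \in X).
Qed.

Definition inner_cut X Y : nat :=
  \sum_e [&& (en e).1 \in X, (en e).2 \in X & ((en e).1 \in Y) (+) ((en e).2 \in Y)].

(** * In-degree targets for the rooted orientation *)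

Section Rooted.

Variables (z : V) (k : nat).
Hypothesis cut_ge : forall X, X != set0 -> z \notin X -> 2 * k <= cut X.

(* In-degree targets: [P] is the set of vertices whose half degree is rounded up.  A minimal
   admissible [P] is covered by tight sets, and this makes the targets realizable. *)
Definition halves (P : {set V}) v := (edeg v)./2 + (v \in P).

(** By [sum_head], in-degrees [halves P] on [X] force at least [k] arcs to enter [X]. *)
Definition half_ok (P : {set V}) : bool :=
  [forall X : {set V}, (X != set0) && (z \notin X) ==>
     (inside setT X + k <= \sum_(v in X) halves P v)].

Lemma half_okP P :
  reflect (forall X, X != set0 -> z \notin X ->
             inside setT X + k <= \sum_(v in X) halves P v) (half_ok P).
Proof.
apply: (iffP forallP) => [h X X0 zX|h X]; first by have := h X; rewrite X0 zX.
by apply/implyP => /andP[X0 zX]; exact: h.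
Qed.

Lemma half_ok_odd : half_ok [set v | odd (edeg v)].
Proof.
apply/half_okP => X X0 zX.
have : \sum_(v in X) edeg v <= 2 * \sum_(v in X) halves [set v | odd (edeg v)] v.
  rewrite big_distrr; apply: leq_sum => v _; rewrite /halves inE /=.
  by rewrite -{1}(odd_double_half (edeg v)); lia.
by have := cut_ge X0 zX; rewrite sum_edeg; lia.
Qed.

Section Minimal.

Variable P : {set V}.
Hypothesis Pmin : minset half_ok P.

Definition tight X : bool :=
  [&& X != set0, z \notin X & \sum_(v in X) halves P v == inside setT X + k].

Lemma P_ok X : X != set0 -> z \notin X ->
  inside setT X + k <= \sum_(v in X) halves P v.
Proof. by case/minsetP: Pmin => /half_okP h _; exact: h. Qed.

(** Dropping [v] from [P] violates the condition for some [X]. The sum drops by at most one, so [X]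
    contains [v] and is tight. *)
Lemma tight_cover v : v \in P -> exists2 X, tight X & v \in X.
Proof.
move=> vP; have nok : ~~ half_ok (P :\ v).
  apply/negP => ok; case/minsetP: Pmin => _ /(_ _ ok (subD1set _ _)) E1.
  by move: vP; rewrite -E1 !inE eqxx.
move: nok; rewrite negb_forall => /existsP[X]; rewrite negb_imply -ltnNge.
case/andP=> /andP[X0 zX] lt; have ge := P_ok X0 zX.
have E1 : \sum_(u in X) halves P u = \sum_(u in X) halves (P :\ v) u + (v \in X).
  rewrite -sum_pred1 -big_split; apply: eq_bigr => u _ /=; rewrite /halves !inE eq_sym.
  by case: eqP => [<-|_] /=; rewrite ?vP; lia.
have vX : v \in X by move: lt ge; rewrite E1; case: (v \in X) => //; lia.
by exists X => //; rewrite /tight X0 zX /= E1 vX; apply/eqP; move: lt ge; rewrite E1 vX; lia.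
Qed.

(** Uncrossing: the target sum is modular and [inside] is supermodular. *)
Lemma tight_setU X Y : tight X -> tight Y -> ~~ [disjoint X & Y] -> tight (X :|: Y).
Proof.
move=> /and3P[X0 zX /eqP tX] /and3P[Y0 zY /eqP tY]; rewrite -setI_eq0 => I0.
have U0 : X :|: Y != set0 by rewrite setU_eq0 negb_and X0.
have zU : z \notin X :|: Y by rewrite inE negb_or zX.
have zI : z \notin X :&: Y by rewrite inE negb_and zX.
rewrite /tight U0 zU /=; apply/eqP.
have := P_ok U0 zU; have := P_ok I0 zI; have := inside_setU setT X Y.
by have := sum_setUI (halves P) X Y; rewrite tX tY; clear; lia.
Qed.

Definition max_tight : {set {set V}} := [set X | maxset tight X].

Lemma trivIset_max_tight : trivIset max_tight.
Proof.
apply/trivIsetP => X Y; rewrite !inE => /maxsetP[tX mX] /maxsetP[tY mY] nXY.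
apply: contraR nXY => nd; have tU := tight_setU tX tY nd.
by rewrite -(mX _ tU (subsetUl _ _)) {1}(mY _ tU (subsetUr _ _)).
Qed.

Lemma notin_cover_max_tight v : v \notin cover max_tight -> v \notin P.
Proof.
apply: contra => /tight_cover[X tX vX]; have [Y mY sXY] := maxset_exists tX.
by apply/bigcupP; exists Y; rewrite ?inE // (subsetP sXY).
Qed.

(** If [X] lies in [Y], tightness and [2 * k <= cut X] suffice. Otherwise subtract the condition for
    [X :\: Y] from the equality for [X]: [k] cancels, and an edge between the two pieces of [X] is
    paid once by [cut (X :&: Y)] and once by [inner_cut]. *)
Lemma double_halves_max_tight X Y : X \in max_tight ->
  \sum_(v in X | v \in Y) 2 * halves P v <=
  \sum_(v in X | v \in Y) edeg v + inner_cut X Y.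
Proof.
rewrite inE => /maxsetP[/and3P[X0 zX /eqP tX] _].
have XY (F : V -> nat) : \sum_(v in X | v \in Y) F v = \sum_(v in X :&: Y) F v.
  by apply: eq_bigl => v; rewrite inE.
rewrite !XY -big_distrr /=.
case: (eqVneq (X :\: Y) set0) => [D0|D0].
  move/eqP: (D0); rewrite setD_eq0 => /setIidPl ->; rewrite tX sum_edeg.
  by have := cut_ge X0 zX; lia.
have zD : z \notin X :\: Y by rewrite inE (negbTE zX) andbF.
have := P_ok D0 zD; have := @big_setID _ _ addn V X Y (halves P).
rewrite tX /= sum_edeg.
suff : 2 * inside setT X <= 2 * inside setT (X :\: Y) + 2 * inside setT (X :&: Y) +
    cut (X :&: Y) + inner_cut X Y by lia.
rewrite !insideT /cut /inner_cut.
rewrite !big_distrr -!big_split; apply: leq_sum => e _ /=; rewrite !inE.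
by case: (_ \in X); case: (_ \in X); case: (_ \in Y); case: (_ \in Y).
Qed.

(** Split [Y] along the disjoint maximal tight sets; a vertex in none of them is not in [P], so its
    half degree is rounded down. *)
Lemma double_halves_le Y :
  2 * \sum_(v in Y) halves P v <=
  \sum_(v in Y) edeg v + \sum_(X in max_tight) inner_cut X Y.
Proof.
have split (F : V -> nat) : \sum_(v in Y) F v =
    \sum_(X in max_tight) \sum_(v in X | v \in Y) F v +
    \sum_(v in Y | v \notin cover max_tight) F v.
  rewrite (bigID (fun v => v \in cover max_tight)) /=; congr addn.
  rewrite -(big_trivIset_cond _ trivIset_max_tight).
  by apply: eq_bigl => v; rewrite andbC.
rewrite big_distrr !split /= addnAC -big_split; apply: leq_add.
  by apply: leq_sum => X XF; exact: double_halves_max_tight.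
apply: leq_sum => v /andP[_ /notin_cover_max_tight vP].
by rewrite /halves (negbTE vP); lia.
Qed.

Lemma sum_inner_cut_le Y : \sum_(X in max_tight) inner_cut X Y <= cut Y.
Proof.
rewrite /inner_cut /cut exchange_big; apply: leq_sum => e _ /=.
case: (_ (+) _); last by rewrite big1 // => X _; rewrite !andbF.
case: (boolP [exists X in max_tight, (en e).1 \in X]) => [/exists_inP[X XF eX]|].
  rewrite (bigD1 X) //= big1; first by rewrite addn0 leq_b1.
  move=> X' /andP[X'F nX]; case: (boolP ((en e).1 \in X')) => //= eX'.
  have := trivIsetP trivIset_max_tight _ _ X'F XF nX.
  by move/pred0P/(_ (en e).1); rewrite /= eX' eX.
move/exists_inPn => h; rewrite big1 // => X /h /negbTE -> //.
Qed.

Lemma edges_split X : #|E| = inside setT X + inside setT (~: X) + cut (~: X).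
Proof.
rewrite -sum1_card !insideT /cut.
rewrite -!big_split; apply: eq_bigr => e _ /=; rewrite !inE.
by case: (_ \in X); case: (_ \in X).
Qed.

(** The root takes the in-degree that is left over, so that the targets sum to [#|E|];
    [indeg_target_root] shows that the subtraction does not truncate. *)
Definition indeg_target v :=
  if v == z then #|E| - \sum_(u in ~: [set z]) halves P u else halves P v.

Lemma sum_indeg_target X : z \notin X ->
  \sum_(v in X) indeg_target v = \sum_(v in X) halves P v.
Proof.
move=> zX; apply: eq_bigr => v vX; rewrite /indeg_target.
by case: eqP => // vz; rewrite -vz vX in zX.
Qed.

(** Tight sets avoid [z], so for the complement of [z] no [inner_cut] term remains, and the other
    targets use at most half of their degree sum. *)
Lemma indeg_target_root : edeg z <= 2 * indeg_target z /\
  \sum_(u in ~: [set z]) halves P u <= #|E|.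
Proof.
rewrite /indeg_target eqxx; set S := \sum_(u in _) _.
have le := double_halves_le (~: [set z]).
have cr0 : \sum_(X in max_tight) inner_cut X (~: [set z]) = 0.
  apply: big1 => X; rewrite inE => /maxsetP[/and3P[_ zX _] _].
  rewrite /inner_cut big1 // => e _; apply/eqP; rewrite eqb0 !inE.
  case: (boolP ((en e).1 \in X)) => //= aX; case: (boolP ((en e).2 \in X)) => //= bX.
  have notz x : x \in X -> x != z by move=> xX; apply: contraNneq zX => <-.
  by rewrite !notz.
have Etot : \sum_v edeg v = 2 * #|E|.
  rewrite (eq_bigl (fun v => v \in [set: V])); last by move=> v; rewrite inE.
  rewrite /edeg exchange_big /= mulnC -sum_nat_const; apply: eq_bigr => e _ /=.
  by rewrite big_split /= !sum_pred1 !inE.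
rewrite (bigD1 z) //= in Etot.
rewrite (eq_bigl (fun v => v \in ~: [set z])) in Etot; last by move=> v; rewrite !inE.
by move: le Etot; rewrite -/S cr0 /=; clear; lia.
Qed.

(** For [z] in [X], pass to the complement: its targets sum to at most its inside plus its cut,
    which is [#|E|] minus the edges inside [X]. *)
Lemma inside_le_indeg_target X : inside setT X <= \sum_(v in X) indeg_target v.
Proof.
case: (boolP (z \in X)) => zX; last first.
  rewrite sum_indeg_target //; case: (eqVneq X set0) => [->|X0].
    by rewrite /inside big1 // => e; rewrite !inE.
  by have := P_ok X0 zX; lia.
rewrite (bigD1 z) //= (eq_bigl (fun v => v \in X :\ z)); last by move=> v; rewrite !inE andbC.
rewrite sum_indeg_target ?inE ?eqxx // /indeg_target eqxx.
have splitX : \sum_(u in ~: [set z]) halves P u =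
    \sum_(u in X :\ z) halves P u + \sum_(u in ~: X) halves P u.
  rewrite (big_setID X) /=; congr (_ + _); apply: eq_bigl => v; rewrite !inE.
    by rewrite andbC.
  by case: (boolP (v \in X)) => //= vX; apply: contraNneq vX => ->.
have := indeg_target_root.2; have := double_halves_le (~: X).
have := sum_inner_cut_le (~: X); rewrite sum_edeg splitX (edges_split X) /=.
by clear; lia.
Qed.

End Minimal.

(** In-degrees are bounded by the targets and both sum to [#|E|], so they agree. *)
Theorem balanced_rooted_orientation :
  exists b : E -> bool,
    [/\ forall X, X != set0 -> z \notin X -> k <= arc_in b X,
        forall v, v != z -> (edeg v)./2 <= \sum_e (head_of b e == v) <= uphalf (edeg v) &
        uphalf (edeg z) <= \sum_e (head_of b e == z)].
Proof.
have [P Pmin Podd] := minset_exists half_ok_odd.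
have [b hb] := orientation_le_indegree (inside_le_indeg_target Pmin).
have hb' v : \sum_e (head_of b e == v) <= indeg_target P v.
  by have := hb v; rewrite (eq_bigl xpredT) // => e; rewrite inE.
have [root_ge root_le] := indeg_target_root Pmin.
have tot : \sum_v \sum_e (head_of b e == v) = \sum_v indeg_target P v.
  transitivity #|E|.
    rewrite exchange_big /= -sum1_card; apply: eq_bigr => e _.
    rewrite (eq_bigl (fun v => v \in setT)); last by move=> v; rewrite inE.
    by rewrite sum_pred1 inE.
  rewrite (bigD1 z) //= (eq_bigl (fun v => v \in ~: [set z])); last by move=> v; rewrite !inE.
  rewrite sum_indeg_target ?inE ?eqxx // /indeg_target eqxx /=; move: root_le => /=; clear; lia.
have indegE v : \sum_e (head_of b e == v) = indeg_target P v.
  apply/eqP; rewrite eqn_leq hb' /=.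
  have := tot; rewrite (bigD1 v) //= [RHS](bigD1 v) //=.
  have : \sum_(i | i != v) \sum_e (head_of b e == i) <= \sum_(i | i != v) indeg_target P i.
    by apply: leq_sum => i _.
  lia.
exists b; split => [X X0 zX|v vz|].
- have := sum_head b X; rewrite (eq_bigr _ (fun v _ => indegE v)) sum_indeg_target //.
  by have := P_ok Pmin X0 zX; lia.
- rewrite indegE /indeg_target (negbTE vz) /halves leq_addr /= uphalf_half addnC leq_add2r.
  by case: (boolP (v \in P)) => // /(subsetP Podd); rewrite inE => ->.
- by rewrite indegE uphalf_half; have := odd_double_half (edeg z); lia.
Qed.

End Rooted.
End Orientation.

(** * Arc-disjoint branchings *)

Section Branchings.

Variables (V E : finType) (hd tl : E -> V) (z : V).
Implicit Types (X Y U : {set V}) (D A : {set E}).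

Definition in_arcs D X : nat := \sum_(e in D) ((hd e \in X) && (tl e \notin X)).

Lemma in_arcs_setU D X Y :
  in_arcs D (X :|: Y) + in_arcs D (X :&: Y) <= in_arcs D X + in_arcs D Y.
Proof.
rewrite /in_arcs -!big_split; apply: leq_sum => e _ /=; rewrite !inE.
by case: (_ \in X); case: (_ \in X); case: (_ \in Y); case: (_ \in Y).
Qed.

Lemma in_arcs_setD1 D e X : e \in D ->
  in_arcs D X = ((hd e \in X) && (tl e \notin X)) + in_arcs (D :\ e) X.
Proof.
move=> eD; rewrite /in_arcs (bigD1 e) //=; congr addn; apply: eq_bigl => e'.
by rewrite !inE andbC.
Qed.

(** An arborescence with root [z] spanning [U]; the increasing [rank] excludes directed cycles and
    so replaces reachability from [z]. *)
Definition branching_on U A : Prop :=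
  exists rank : V -> nat,
    [/\ z \in U,
        forall e, e \in A -> [/\ rank (tl e) < rank (hd e), tl e \in U, hd e \in U & hd e != z],
        {in A &, injective hd} &
        forall v, v \in U -> v != z -> exists2 e, e \in A & hd e = v].

Definition branching := branching_on setT.

Lemma branching_add U A e : branching_on U A -> tl e \in U -> hd e \notin U ->
  branching_on (hd e |: U) (e |: A).
Proof.
move=> [rank [zU hA injA covA]] tU hU.
pose r' v := if v == hd e then (rank (tl e)).+1 else rank v.
have r'U v : v \in U -> r' v = rank v.
  by rewrite /r'; case: eqP => // -> ; rewrite (negbTE hU).
exists r'; split.
- by rewrite !inE zU orbT.
- move=> e'; rewrite !inE => /predU1P[->|/hA[lt tU' hU' nz]].
    rewrite r'U // {1}/r' !eqxx tU orbT; split=> //.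
    by apply: contraNneq hU => ->.
  by rewrite !r'U // tU' hU' !orbT.
- move=> e1 e2; rewrite !inE => /predU1P[->|A1] /predU1P[->|A2] //.
  + by move=> eh; have [_ _ h _] := hA _ A2; rewrite -eh (negbTE hU) in h.
  + by move=> eh; have [_ _ h _] := hA _ A1; rewrite eh (negbTE hU) in h.
  + exact: injA.
- move=> v; rewrite !inE => /predU1P[-> _|vU vz]; first by exists e; rewrite ?inE ?eqxx.
  by have [e' e'A he'] := covA _ vU vz; exists e'; rewrite ?inE ?e'A ?orbT.
Qed.

(* Lovasz's argument: the new arc is taken inside a minimal set that may not lose any more arcs. *)
Lemma branching_extend k D U A :
  (forall X, X != set0 -> z \notin X -> k.+1 <= in_arcs D X) ->
  A \subset D -> branching_on U A -> U != setT ->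
  (forall X, X != set0 -> z \notin X -> k <= in_arcs (D :\: A) X) ->
  exists e, [/\ e \in D :\: A, tl e \in U, hd e \notin U &
    forall X, X != set0 -> z \notin X -> k <= in_arcs (D :\: A :\ e) X].
Proof.
move=> hD AD [rank [zU hA injA covA]] UT hDA.
(* Dangerous sets cannot lose an arc and are not contained in [U]; a set entered by an arc leaving
   [U] is never contained in [U]. *)
pose dang X := [&& z \notin X, in_arcs (D :\: A) X == k & ~~ (X \subset U)].
have noA X : in_arcs D (X :\: U) = in_arcs (D :\: A) (X :\: U).
  rewrite /in_arcs (bigID (fun e => e \in A)) /= big1 ?add0n.
    by apply: eq_bigl => e; rewrite !inE andbC.
  by move=> e /andP[_ /hA[_ _ hU _]]; rewrite !inE hU.
have arc X (W : {set V}) : X \subset W -> z \notin X -> X != set0 ->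
    in_arcs (D :\: A) W < in_arcs (D :\: A) X ->
    exists2 e, e \in D :\: A & [/\ hd e \in X, tl e \notin X & tl e \in W].
  move=> XW zX X0 lt.
  case: (boolP [exists e in D :\: A, [&& hd e \in X, tl e \notin X & tl e \in W]]).
    by case/exists_inP => e eD /and3P[h1 h2 h3]; exists e.
  move/exists_inPn => none; move: lt; rewrite ltnNge => /negP[].
  apply: leq_sum => e /none; case hX: (hd e \in X) => //=; rewrite (subsetP XW _ hX).
  by case: (tl e \in X) => //= /negbTE ->.
case: (boolP [exists X, dang X]) => [/existsP[X0 dX0]|/existsPn none]; last first.
  have C0 : ~: U != set0 by apply: contraNneq UT => C0; rewrite -(setCK U) C0 setC0.
  have zC : z \notin ~: U by rewrite inE zU.
  have [||||e eD [h1 h2 _]] := arc (~: U) setT; rewrite ?subsetT //.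
    rewrite -(setTD U) -noA setTD {1}/in_arcs big1 => [|e]; last by rewrite !inE.
    exact: leq_trans (hD _ C0 zC).
  move: h1 h2; rewrite !inE negbK => h1 h2; exists e; split => // X X0 zX.
  have := hDA _ X0 zX; have := none X; rewrite /dang zX (in_arcs_setD1 _ eD) /=.
  case: (boolP (hd e \in X)) => //= hX; case: (tl e \in X) => //=.
  by rewrite (_ : ~~ (X \subset U)) ?andbT; [clear; lia | apply: contra h1 => /subsetP ->].
have [X /minsetP[/and3P[zX /eqP dX XU] mX] _] := minset_exists dX0.
have D0 : X :\: U != set0 by rewrite setD_eq0.
have zXU : z \notin X :\: U by rewrite inE (negbTE zX) andbF.
(* [X] has only [k] entering arcs and [X :\: U] has more, so some arc runs from [X :&: U] to
   [X :\: U]. *)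
have [|e eD [h1 h2 h3]] := arc (X :\: U) X (subsetDl _ _) zXU D0.
  by rewrite dX -noA; exact: hD.
move: h1 h2; rewrite !inE h3 andbT negbK => /andP[h1 hX] h2.
exists e; split=> // Y Y0 zY; have := hDA _ Y0 zY; rewrite (in_arcs_setD1 _ eD).
case: (boolP (hd e \in Y)) => //= hY; case: (boolP (tl e \in Y)) => //= tY.
(* If [e] harmed [Y], submodularity would make [X :&: Y] dangerous; it misses [tl e], against the
   minimality of [X]. *)
rewrite add1n leq_eqVlt => /predU1P[kY|]; last by rewrite ltnS.
have dY : in_arcs (D :\: A) Y = k by rewrite (in_arcs_setD1 _ eD) hY tY /= add1n -kY.
have I0 : X :&: Y != set0 by apply/set0Pn; exists (hd e); rewrite inE hX.
have zI : z \notin X :&: Y by rewrite inE (negbTE zX).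
have zU' : z \notin X :|: Y by rewrite inE negb_or zX.
have U0 : X :|: Y != set0 by rewrite setU_eq0 negb_and Y0 orbT.
have dI : dang (X :&: Y).
  rewrite /dang zI /= (_ : ~~ (_ \subset U)) ?andbT; last first.
    by apply: contra h1 => /subsetP -> //; rewrite inE hX.
  have := hDA _ I0 zI; have := hDA _ U0 zU'; have := in_arcs_setU (D :\: A) X Y.
  by rewrite dX dY; clear; lia.
have := mX _ dI (subsetIl _ _) => /setP/(_ (tl e)).
by rewrite inE h3 (negbTE tY).
Qed.

Lemma branching_exists k D :
  (forall X, X != set0 -> z \notin X -> k.+1 <= in_arcs D X) ->
  exists2 A : {set E}, A \subset D &
    branching A /\ forall X, X != set0 -> z \notin X -> k <= in_arcs (D :\: A) X.
Proof.
move=> hD.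
suff grow n : n < #|V| -> exists U A,
    [/\ #|U| = n.+1, A \subset D, branching_on U A &
        forall X, X != set0 -> z \notin X -> k <= in_arcs (D :\: A) X].
  have V0 : 0 < #|V| by apply/card_gt0P; exists z.
  have [|U [A [cU AD bA hA]]] := grow #|V|.-1; first by rewrite prednK.
  exists A => //; split=> //; rewrite /branching.
  suff -> : setT = U by [].
  by apply/esym/eqP; rewrite eqEcard subsetT cardsT cU prednK /=.
elim: n => [|n IH] ltn.
  exists [set z], set0; rewrite cards1 sub0set setD0; split => //.
    by exists (fun=> 0); split=> [|e|e1 e2|v]; rewrite ?inE // => -> .
  by move=> X X0 zX; exact: ltnW (hD _ X0 zX).
have [U [A [cU AD bA hA]]] := IH (ltnW ltn).
have UT : U != setT by apply: contraTneq ltn => UT; rewrite -leqNgt -cU UT cardsT.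
have [e [eD tU hU hX]] := branching_extend hD AD bA UT hA.
exists (hd e |: U), (e |: A); split.
- by rewrite cardsU1 hU cU.
- by rewrite subUset AD sub1set; move: eD; rewrite inE => /andP[_ ->].
- exact: branching_add.
- move=> X X0 zX; rewrite (_ : D :\: (e |: A) = D :\: A :\ e); first exact: hX.
  by apply/setP => e'; rewrite !inE negb_or andbA.
Qed.

(** Edmonds' theorem: branchings are peeled off one at a time, each lowering the bound on entering
    arcs by only one. *)
Theorem disjoint_branchings k D :
  (forall X, X != set0 -> z \notin X -> k <= in_arcs D X) ->
  exists A : nat -> {set E},
    [/\ forall i, i < k -> A i \subset D,
        forall i, i < k -> branching (A i) &
        forall i j, i < k -> j < k -> i != j -> [disjoint A i & A j]].
Proof.
elim: k D => [|k IH] D hD; first by exists (fun=> set0).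
have [B BD [bB hB]] := branching_exists hD.
have [A [AD bA dA]] := IH _ hB.
have AB i : i < k -> [disjoint A i & B].
  move=> ik; rewrite -setI_eq0 -subset0; apply/subsetP => e; rewrite !inE.
  by case/andP => /(subsetP (AD _ ik)); rewrite inE => /andP[/negbTE ->].
exists (fun i => if i == k then B else A i); split=> [i ik|i ik|i j ik jk].
- case: eqVneq => // nik; apply: subset_trans (AD i _) (subsetDl _ _); lia.
- by case: eqVneq => // nik; apply: bA; lia.
- case: (eqVneq i k) => [ei|ni]; case: (eqVneq j k) => [ej|nj] nij.
  + by rewrite ei ej eqxx in nij.
  + by rewrite disjoint_sym; apply: AB; lia.
  + by apply: AB; lia.
  + by apply: dA => //; lia.
Qed.

End Branchings.

(** * Splitting off and colouring *)

Lemma sum_bool_card (T : finType) (A : {set T}) (p : pred T) :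
  \sum_(x in A) (p x : nat) = #|[set x in A | p x]|.
Proof.
rewrite -sum1_card big_mkcond [RHS]big_mkcond; apply: eq_bigr => x _.
by rewrite inE; case: (x \in A); case: (p x).
Qed.

Section Colouring.

Variables (V E : finType) (hd : E -> V) (z : V) (ev : V -> E).
Implicit Types (tl : E -> V) (s c : E -> bool) (D : {set E}) (v u w : V) (e i o : E).

Hypothesis hd_ev : forall v, v != z -> hd (ev v) = v.

(** The branching kept for parities, given by the arc [ev v] entering each [v]. Splitting off
    changes only tails, so this arc set stays the same. *)
Definition stem : {set E} := [set e | (hd e != z) && (ev (hd e) == e)].

Lemma ev_stem v : v != z -> ev v \in stem.
Proof. by move=> vz; rewrite inE hd_ev // vz eqxx. Qed.

(* The number of coloured edge ends at [v]; the tail of [e] has the colour of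
   its head, reversed when [s e] holds. *)
Definition ends_at D tl s c v : nat :=
  \sum_(e in D) (((hd e == v) && c e) + ((tl e == v) && (c e (+) s e))).

Definition ranked tl (rank : V -> nat) := forall v, v != z -> rank (tl (ev v)) < rank v.

(** Flipping [ev v] changes the parity exactly at [v] and its parent, so defects can be pushed
    towards [z], where no parity is asked. *)
Lemma stem_parity D tl s rank c1 (f : V -> bool) :
  stem \subset D -> ranked tl rank ->
  exists c, (forall e, e \notin stem -> c e = c1 e) /\
            (forall v, v != z -> odd (ends_at D tl s c v) = f v).
Proof.
move=> sD rk.
pose bad c v := (v != z) && (odd (ends_at D tl s c v) != f v).
(* Moving a defect to a parent, of smaller rank, decreases this weight; a minimizer has no
   defect. *)
pose M (c : {ffun E -> bool}) := \sum_v bad c v * (rank v).+1.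
pose Q (c : {ffun E -> bool}) := [forall e, (e \notin stem) ==> (c e == c1 e)].
have Q1 : Q (finfun c1) by apply/forallP => e; apply/implyP => _; rewrite ffunE.
case: (arg_minnP M Q1) => c Qc minc.
exists c; split=> [e es|v vz]; first by apply/eqP; exact: implyP (forallP Qc e) es.
apply/eqP/negPn/negP => badv.
pose e := ev v; pose c' := [ffun x => c x (+) (x == e)].
have eD : e \in D by apply: (subsetP sD); exact: ev_stem.
have Qc' : Q c'.
  apply/forallP => x; apply/implyP => xs; rewrite ffunE.
  have -> : (x == e) = false by apply: contraNF xs => /eqP ->; exact: ev_stem.
  by rewrite addbF; exact: implyP (forallP Qc x) xs.
have flip u : odd (ends_at D tl s c' u) =
    odd (ends_at D tl s c u) (+) (v == u) (+) (tl e == u).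
  rewrite /ends_at (bigD1 e) //= [in RHS](bigD1 e) //= !ffunE eqxx hd_ev //.
  rewrite (eq_bigr (fun x => ((hd x == u) && c x) + ((tl x == u) && (c x (+) s x)))).
    rewrite !oddD !oddb; set r := odd _.
    by case: (v == u); case: (tl e == u); case: (c e); case: (s e); case: r.
  by move=> x /andP[_ /negbTE nx]; rewrite !ffunE nx addbF.
have ptv : tl e != v by apply: contraTneq (rk _ vz) => E1; rewrite -/e E1 ltnn.
have := minc _ Qc'; apply/negP; rewrite -ltnNge /M.
rewrite (bigD1 v) //= (bigD1 (tl e)) //= [ltnRHS](bigD1 v) //= [X in _ < _ + X](bigD1 (tl e)) //=.
rewrite (_ : bad c v = true) /bad ?vz //.
rewrite flip eqxx (negbTE ptv) addbF addbT.
rewrite (_ : (~~ _ != f v) = false); last by move: badv; case: (odd _); case: (f v).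
rewrite (eq_bigr (fun u => ((u != z) && (odd (ends_at D tl s c u) != f u)) * (rank u).+1)).
  have := rk _ vz; rewrite -/e; set r := \sum_(_ | _) _.
  set b := (_ && _ : nat); set b' := (_ && _ : nat).
  by have : b <= 1 := leq_b1 _; clear; nia.
move=> u /andP[uv ut]; by rewrite flip (eq_sym v) (negbTE uv) (eq_sym (tl e)) (negbTE ut) !addbF.
Qed.

(** * Splitting off a pair of arcs *)

Definition split_tail tl i o e := if e == o then tl i else tl e.
(** The merged arc keeps the name and head colour of [o]. If [i] and [o] have opposite colours where
    they meet, this twist gives the new tail the colour that [i] has at [tl i]. *)
Definition split_twist s i o e := if e == o then ~~ (s o (+) s i) else s e.

Lemma sum_split D i o (F F' : E -> nat) (d : nat) :
  i \in D -> o \in D -> o != i -> F i + F o = d + F' o ->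
  (forall e, e != i -> e != o -> F e = F' e) ->
  \sum_(e in D) F e = d + \sum_(e in D :\ i) F' e.
Proof.
move=> iD oD oi hio hF.
rewrite (bigD1 i) //= (bigD1 o) ?oD //= addnA hio.
rewrite [in RHS](bigD1 o) /= ?inE ?oi //= addnA; congr addn.
rewrite [RHS](eq_bigl (fun e => (e \in D) && (e != i) && (e != o))).
  by apply: eq_bigr => e /andP[/andP[_ ei] eo]; exact: hF.
by move=> e; rewrite !inE; case: (e != i); case: (e \in D); case: (e != o).
Qed.

(** Of the two ends meeting at [hd i] exactly one is coloured; the outer ends become those of the
    merged arc. *)
Lemma ends_at_split D tl s c i o v :
  i \in D -> o \in D -> o != i -> tl o = hd i -> c i = ~~ (c o (+) s o) ->
  ends_at D tl s c v =
  (hd i == v) + ends_at (D :\ i) (split_tail tl i o) (split_twist s i o) c v.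
Proof.
move=> iD oD oi to ci; apply: sum_split iD oD oi _ _ => [|e ei /negbTE eo].
  rewrite /split_tail /split_twist eqxx to ci.
  by case: (hd i == v); case: (hd o == v); case: (tl i == v); case: (c o); case: (s o); case: (s i).
by rewrite /split_tail /split_twist eo.
Qed.

(** With [z] a fixed point, [fconnect (parent tl) v w] says that [w] is [v] or an ancestor of
    [v]. *)
Definition parent tl v := if v == z then z else tl (ev v).

Lemma fconnect_parent tl rank v w : ranked tl rank ->
  fconnect (parent tl) v w -> rank w <= rank v.
Proof.
move=> rk /iter_findex <-; elim: (findex _ _ _) => //= n IH.
apply: leq_trans IH; rewrite {1}/parent; case: eqVneq => [<-|/rk/ltnW] //.
Qed.

Lemma fconnect_parent_neq tl v w : v != w ->
  fconnect (parent tl) v w -> fconnect (parent tl) (parent tl v) w.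
Proof.
move=> vw vw'; have := iter_findex vw'; case: (findex _ _ _) => [/= E1|n].
  by rewrite E1 eqxx in vw.
by rewrite iterSr => <-; exact: fconnect_iter.
Qed.

(** Ancestors of [x] form a chain. Of two distinct children of [u] on it, the later would be an
    ancestor of the earlier, hence of [u], its own parent. *)
Lemma fconnect_siblings tl rank x w1 w2 u : ranked tl rank ->
  parent tl w1 = u -> parent tl w2 = u -> w1 != z -> w2 != z ->
  fconnect (parent tl) x w1 -> fconnect (parent tl) x w2 -> w1 = w2.
Proof.
move=> rk; wlog le : w1 w2 / findex (parent tl) x w1 <= findex (parent tl) x w2.
  case: (leqP (findex (parent tl) x w1) (findex (parent tl) x w2)) =>
    [|/ltnW] le W p1 p2 z1 z2 c1 c2.
    exact: (W w1 w2).
  by apply/esym; apply: (W w2 w1).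
move=> p1 p2 z1 z2 c1 c2; apply/eqP/negPn/negP => w12.
have c12 : fconnect (parent tl) w1 w2.
  by rewrite -(iter_findex c2) -(subnK le) iterD (iter_findex c1) fconnect_iter.
have := fconnect_parent rk (fconnect_parent_neq w12 c12).
by rewrite p1 -p2 /parent (negbTE z2) leqNgt rk.
Qed.

(* Moving the subtree of [hd o] behind everything else makes room for its new parent [tl i]. *)
Lemma ranked_split tl rank i o : ranked tl rank ->
  (o \in stem -> ~~ fconnect (parent tl) (tl i) (hd o)) ->
  exists rank', ranked (split_tail tl i o) rank'.
Proof.
move=> rk; case: (boolP (o \in stem)) => os; last first.
  move=> _; exists rank => v vz; rewrite /split_tail; case: eqP => [E1|_]; last exact: rk.
  by rewrite -E1 ev_stem in os.
move=> /(_ isT) nd; pose N := (\sum_v rank v).+1.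
have ltN v : rank v < N by rewrite ltnS (bigD1 v) //= leq_addr.
exists (fun v => rank v + N * fconnect (parent tl) v (hd o)) => v vz.
rewrite /split_tail; case: eqP => [E1|_].
  rewrite (negbTE nd) muln0 addn0 -E1 hd_ev // connect0 muln1.
  by apply: leq_trans (ltN _) _; rewrite leq_addl.
rewrite -addSn; apply: leq_add; first exact: rk.
rewrite leq_mul2l; apply/orP; right.
case: (boolP (fconnect _ (tl _) _)) => // pc.
rewrite (_ : fconnect (parent tl) v (hd o)) //.
apply: connect_trans pc; apply: connect1.
by rewrite /= /parent (negbTE vz).
Qed.

(** Two bad candidates would be stem arcs to siblings that are both ancestors of [tl i]. If one
    candidate is [i], then [i] is a loop, and the other is safe because rank increases along stem
    arcs. *)
Lemma split_choice tl rank i o1 o2 : ranked tl rank ->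
  i \notin stem -> o1 != o2 -> tl o1 = hd i -> tl o2 = hd i ->
  exists2 o, (o == o1) || (o == o2) &
    o != i /\ (o \in stem -> ~~ fconnect (parent tl) (tl i) (hd o)).
Proof.
move=> rk istem o12 t1 t2.
have par o : o \in stem -> parent tl (hd o) = tl o.
  by rewrite inE /parent => /andP[/negbTE -> /eqP ->].
have hz o : o \in stem -> hd o != z by rewrite inE => /andP[].
have loop o : tl i = hd i -> tl o = hd i -> o \in stem -> ~~ fconnect (parent tl) (tl i) (hd o).
  move=> ti to os; apply/negP => /(fconnect_parent rk); rewrite ti -to -par //.
  by rewrite /parent (negbTE (hz _ os)) leqNgt rk ?hz.
case: (eqVneq o1 i) => [e1|n1].
  exists o2; rewrite ?eqxx ?orbT //; split; first by rewrite -e1 eq_sym.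
  by apply: loop => //; rewrite -t1 e1.
case: (eqVneq o2 i) => [e2|n2].
  exists o1; rewrite ?eqxx //; split => //.
  by apply: loop => //; rewrite -t2 e2.
case: (boolP ((o1 \in stem) && fconnect (parent tl) (tl i) (hd o1))) =>
  [/andP[s1 c1]|h1]; last first.
  by exists o1; rewrite ?eqxx //; split=> // s1; move: h1; rewrite s1.
exists o2; rewrite ?eqxx ?orbT //; split=> // s2; apply/negP => c2.
have E1 := fconnect_siblings rk (par _ s1) _ (hz _ s1) (hz _ s2) c1 c2.
move: o12; move: (s1) (s2); rewrite !inE => /andP[_ /eqP <-] /andP[_ /eqP <-].
by rewrite E1 ?eqxx // par // t1.
Qed.

(** * Colourings by successive splitting *)

Variables (K B : {set E}) (c0 : E -> bool).
Hypothesis K_stem : forall e, e \in K -> e \notin stem.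
Hypothesis K_root : forall e, e \in K -> hd e != z.
Hypothesis BK : B \subset K.

Definition free_in D v : nat := \sum_(e in D) [&& hd e == v, e \notin K & e \notin stem].
(** Possible leaving partners. Only [B] is excluded, as its tails at [z] are counted by
    [fixed_root]; other arcs of [K] qualify, since their fixed colours are counted at heads, which
    do not move. *)
Definition free_out D tl v : nat := \sum_(e in D) ((tl e == v) && (e \notin B)).
Definition fixed_in (b : bool) v : nat := \sum_(e in K) ((hd e == v) && (c0 e == b)).
Definition fixed_root : nat := \sum_(e in B) c0 e.

Lemma sum_setD1 D i (F : E -> nat) : i \in D ->
  \sum_(e in D) F e = F i + \sum_(e in D :\ i) F e.
Proof.
move=> iD; rewrite (bigD1 i) //=; congr addn; apply: eq_bigl => e.
by rewrite !inE andbC.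
Qed.

Lemma ends_at_fixed D tl s c v (b : bool) : K \subset D ->
  (forall e, e \in K -> c e = c0 e) ->
  fixed_in b v <= ends_at D tl s (fun e => c e == b) v.
Proof.
move=> KD hc; rewrite /ends_at (bigID (fun e => e \in K)) /=.
apply: leq_trans (leq_addr _ _); rewrite (eq_bigl (fun e => e \in K)).
  by apply: leq_sum => e eK; rewrite hc // leq_addr.
by move=> e; case eK: (e \in K); rewrite ?andbF // (subsetP KD _ eK).
Qed.

(** With no pair left, colour [j] free arcs entering [z] and correct parities along the stem, which
    never enters [z]. Only the last free arc leaving [z] is uncontrolled there. *)
Lemma colouring_base D tl s rank j (f : V -> bool) :
  stem \subset D -> K \subset D -> ranked tl rank ->
  (forall e, e \in B -> tl e = z /\ s e = false) ->
  free_out D tl z = 1 ->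
  j <= free_in D z ->
  exists c, [/\ forall e, e \in K -> c e = c0 e,
    forall v, v != z -> odd (ends_at D tl s c v) = f v &
    fixed_root + j <= ends_at D tl s c z <= fixed_root + j + 1].
Proof.
move=> sD KD rk hB out1; rewrite /free_in sum_bool_card => /card_geqP[J [uJ szJ subJ]].
have [c [cs cf]] := stem_parity s (fun e => if e \in K then c0 e else e \in J) f sD rk.
have cK e : e \in K -> c e = c0 e by move=> eK; rewrite cs ?eK ?K_stem.
exists c; split=> //.
rewrite /ends_at big_split /=.
have -> : \sum_(e in D) ((hd e == z) && c e : nat) = j.
  rewrite sum_bool_card -szJ -(card_uniqP uJ); apply: eq_card => e.
  rewrite !inE; apply/idP/idP => [/and3P[eD ez]|eJ].
    rewrite cs; last by rewrite inE (eqP ez) eqxx.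
    by case: ifP => // /K_root; rewrite ez.
  have := subJ _ eJ; rewrite !inE => /and4P[-> ez eK es]; rewrite ez /=.
  by rewrite cs ?(negbTE eK) // inE.
rewrite (bigID (fun e => e \in B)) /=.
have -> : \sum_(e in D | e \in B) ((tl e == z) && (c e (+) s e) : nat) = fixed_root.
  rewrite /fixed_root (eq_bigl (fun e => e \in B)); last first.
    move=> e; case eB: (e \in B); rewrite ?andbF // andbT.
    by apply: (subsetP KD); apply: (subsetP BK).
  apply: eq_bigr => e eB; have [-> ->] := hB _ eB.
  by rewrite eqxx addbF cK // (subsetP BK).
set r := \sum_(_ | _) _.
suff : r <= 1 by rewrite (addnC fixed_root); lia.
rewrite -out1 /free_out [leqRHS](bigID (fun e => e \in B)) /=.
apply: leq_trans (leq_addl _ _); apply: leq_sum => e /andP[_ ->].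
by rewrite andbT; case: (tl e == z) => //; rewrite leq_b1.
Qed.

(** Induction on the number of pairs to split off. Each gives its vertex one end of either colour,
    and [q v < free_out D tl v] provides the two candidates that [split_choice] needs. *)
Lemma colouring D tl s (q : V -> nat) rank j (f : V -> bool) :
  stem \subset D -> K \subset D -> ranked tl rank ->
  (forall e, e \in B -> tl e = z /\ s e = false) ->
  (forall v, v != z -> q v <= free_in D v) ->
  (forall v, 0 < q v -> q v < free_out D tl v) ->
  free_out D tl z = (q z).+1 ->
  q z + j <= free_in D z ->
  exists c, [/\ forall v, v != z -> odd (ends_at D tl s c v) = f v,
    forall e, e \in K -> c e = c0 e,
    forall v b, v != z -> q v + fixed_in b v <= ends_at D tl s (fun e => c e == b) v &
    fixed_root + q z + j <= ends_at D tl s c z <= fixed_root + q z + j + 1].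
Proof.
elim: {q}(\sum_v q v) {-2}q (erefl (\sum_v q v)) D tl s rank f
  => [|n IH] q sumq D tl s rank f sD KD rk hB hin hout outz inz.
  have q0 v : q v = 0.
    by apply/eqP; move/eqP: sumq; rewrite sum_nat_eq0 => /forallP/(_ v).
  rewrite q0 in outz; rewrite q0 add0n in inz.
  have [c [cK cf cz]] := colouring_base f sD KD rk hB outz inz.
  exists c; split=> // [v b vz|]; rewrite q0 ?addn0 //.
  by rewrite add0n; exact: ends_at_fixed.
have [u qu] : exists u, 0 < q u.
  apply/existsP; rewrite -[X in is_true X]negbK negb_exists; apply/negP => /forallP h.
  by move: sumq; rewrite big1 // => v _; apply/eqP; rewrite -leqn0 leqNgt h.
have hin' v : q v <= free_in D v.
  by case: (eqVneq v z) => [->|/hin //]; exact: leq_trans (leq_addr _ _) inz.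
have /card_gt0P[i] : 0 < #|[set e in D | [&& hd e == u, e \notin K & e \notin stem]]|.
  by rewrite -sum_bool_card; exact: leq_trans qu (hin' u).
rewrite inE => /and4P[iD /eqP hi iK istem].
have /card_gt1P[o1 [o2 [o1P o2P o12]]] : 1 < #|[set e in D | (tl e == u) && (e \notin B)]|.
  by rewrite -sum_bool_card; exact: leq_ltn_trans qu (hout u qu).
have [o oo [oi onc]] : exists2 o, (o == o1) || (o == o2) &
    o != i /\ (o \in stem -> ~~ fconnect (parent tl) (tl i) (hd o)).
  apply: (split_choice rk istem o12).
    by move: o1P; rewrite inE hi => /and3P[_ /eqP].
  by move: o2P; rewrite inE hi => /and3P[_ /eqP].
have : o \in [set e in D | (tl e == u) && (e \notin B)] by case/orP: oo => /eqP ->.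
rewrite inE => /and3P[oD /eqP to oB] {o1 o2 o1P o2P o12 oo}.
have iB : i \notin B by apply: contra iK; exact: (subsetP BK).
have [rank' rk'] := ranked_split rk onc.
pose tl' := split_tail tl i o; pose s' := split_twist s i o.
pose q' v := q v - (v == u).
have qE v : q v = (u == v) + q' v.
  by rewrite /q' eq_sym; case: eqP => [->|_] /=; move: qu; clear; lia.
have inE' v : free_in D v = (u == v) + free_in (D :\ i) v.
  by rewrite /free_in (sum_setD1 _ iD) hi iK istem !andbT.
have outE v : free_out D tl v = (u == v) + free_out (D :\ i) tl' v.
  apply: sum_split iD oD oi _ _ => [|e ei /negbTE eo]; rewrite /tl' /split_tail ?eo //.
  by rewrite eqxx to iB oB !andbT addnC.
have endsE c v : c i = ~~ (c o (+) s o) ->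
    ends_at D tl s c v = (u == v) + ends_at (D :\ i) tl' s' c v.
  by move=> ci; rewrite (ends_at_split _ iD oD oi _ ci) ?hi ?to.
have sumq' : \sum_v q' v = n.
  have : \sum_v q v = 1 + \sum_v q' v.
    rewrite (eq_bigr _ (fun v _ => qE v)) big_split /=; congr addn.
    by rewrite (bigD1 u) //= eqxx big1 // => v; rewrite eq_sym => /negbTE ->.
  by rewrite sumq; clear; lia.
(* The split pair puts one coloured end at [u], so the parity wanted there is reversed. *)
have [|||v vz|v|||c [cf cK cq cz]] :=
    IH q' sumq' (D :\ i) tl' s' rank' (fun v => f v (+) (u == v)) _ _ rk'.
- by rewrite subsetD1 sD.
- by rewrite subsetD1 KD.
- move=> e eB; rewrite /tl' /s' /split_tail /split_twist.
  by rewrite (_ : (e == o) = false) //; [exact: hB | apply: contraNF oB => /eqP <-].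
- by have := hin v vz; rewrite qE inE' leq_add2l.
- by move=> q'v; have := hout v; rewrite qE outE ltn_add2l => -> //; rewrite addn_gt0 q'v orbT.
- by have := outz; rewrite outE qE -addnS => /addnI.
- by have := inz; rewrite inE' qE -addnA leq_add2l.
pose c' e := if e == i then ~~ (c o (+) s o) else c e.
have c'i : c' i = ~~ (c' o (+) s o) by rewrite /c' eqxx (negbTE oi).
have same (F : bool -> bool) v :
    ends_at (D :\ i) tl' s' (fun e => F (c' e)) v =
    ends_at (D :\ i) tl' s' (fun e => F (c e)) v.
  by apply: eq_bigr => e; rewrite !inE /c' => /andP[/negbTE -> _].
exists c'; split.
- move=> v vz; rewrite endsE // oddD oddb (same id) cf //.
  by case: (u == v); case: (f v).
- move=> e eK; rewrite /c' (_ : (e == i) = false) ?cK //.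
  by apply: contraNF iK => /eqP <-.
(* The relation between [c' i] and [c' o] survives complementing all colours, so one identity counts
   both colours. *)
- move=> v b vz; rewrite endsE; last by rewrite c'i; case: b; case: (c' o); case: (s o).
  by rewrite (same (fun x => x == b)) qE -addnA leq_add2l cq.
- rewrite endsE // (same id) -[fun e => id (c e)]/c qE; move: cz; clear; lia.
Qed.

End Colouring.

(** * Parity factors *)

Section Trees.

Variables (G : mgraph) (hd tl : edge G -> vert G) (z : vert G).
Hypothesis joins_arc : forall e, joins e (tl e) (hd e).

Lemma joinsE e u v : joins e u v -> (u = tl e /\ v = hd e) \/ (u = hd e /\ v = tl e).
Proof.
move: (joins_arc e); rewrite /joins => /orP[]/eqP -> /orP[]/eqP[-> ->]; by [left|right].
Qed.

(** Parents of decreasing rank lead to [z]. On a cycle, a vertex of maximal rank would be the head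
    of both its cycle edges; they coincide in a loop, which the rank excludes. *)
Lemma branching_spanning_tree A : branching hd tl z A -> spanning_tree A.
Proof.
move=> [rank [_ hA injA covA]]; split.
  split; first by apply/card_gt0P; exists z.
  have adjC u v : adj A u v = adj A v u.
    by apply/exists_inP/exists_inP => -[e eA je]; exists e; rewrite // /joins orbC.
  have fromz v : connect (adj A) z v.
    elim: {v}(rank v).+1 {-2}v (ltnSn (rank v)) => // n IH v.
    rewrite ltnS => rv; case: (eqVneq v z) => [->|vz]; first exact: connect0.
    have [e eA ev] := covA v (in_setT _) vz; have [lt _ _ _] := hA _ eA.
    apply: (connect_trans (IH (tl e) _)); first by apply: leq_trans lt _; rewrite ev.
    by apply: connect1; apply/exists_inP; exists e; rewrite // -ev joins_arc.
  move=> u v; apply: connect_trans (fromz v).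
  by rewrite (sym_connect_sym adjC).
move=> [n [v [e [injv inje he]]]].
have rk i : [\/ tl (e i) = v i /\ hd (e i) = v (ordS i) |
              tl (e i) = v (ordS i) /\ hd (e i) = v i].
  have [_ /joinsE[[-> ->]|[-> ->]]] := he i; by [left|right].
have [i _ maxi] := arg_maxnP (fun i => rank (v i)) (isT : xpredT (ord0 : 'I_n.+1)).
have {}maxi j : rank (v j) <= rank (v i) by exact: maxi.
have lt i' : rank (tl (e i')) < rank (hd (e i')).
  by have [eA _] := he i'; have [] := hA _ eA.
have hi : hd (e i) = v i.
  case: (rk i) => [[t h]|[]] //; have := lt i; rewrite t h => l.
  by have := maxi (ordS i); rewrite leqNgt l.
have hp : hd (e (ord_pred i)) = v i.
  case: (rk (ord_pred i)) => [[_]|[]]; rewrite ord_predK // => t h.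
  have := lt (ord_pred i); rewrite t h => l.
  by have := maxi (ord_pred i); rewrite leqNgt l.
have /inje E1 : e i = e (ord_pred i).
  by apply: injA; rewrite ?hi ?hp //; [have [] := he i | have [] := he (ord_pred i)].
have := lt i; case: (rk i) => [[-> ->]|[-> ->]];
  by rewrite {2}E1 ord_predK ltnn || by rewrite {1}E1 ord_predK ltnn.
Qed.

Lemma branching_sum_head A v : branching hd tl z A ->
  \sum_(e in A) (hd e == v) = (v != z).
Proof.
move=> [rank [_ hA injA covA]]; case: (eqVneq v z) => [->|vz] /=.
  by rewrite big1 // => e /hA[_ _ _ /negbTE ->].
have [e eA <-] := covA v (in_setT _) vz; rewrite (bigD1 e) //= eqxx big1 //.
move=> e' /andP[e'A ne]; case: eqP => // /(injA _ _ e'A eA) E1.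
by rewrite E1 eqxx in ne.
Qed.

(** A vertex of minimal rank among those other than [z] has [z] as its parent. *)
Lemma branching_root_arc A : branching hd tl z A -> 1 < #|vert G| ->
  0 < \sum_(e in A) (tl e == z).
Proof.
move=> [rank [_ hA injA covA]] V1.
have [v vz] : exists v, v != z.
  case/card_gt1P: V1 => x [y [_ _ xy]]; case: (eqVneq x z) => [xz|]; last by exists x.
  by exists y; rewrite -xz eq_sym.
have [u uz minu] := @arg_minnP _ v (fun u => u != z) rank vz.
have [e eA eu] := covA u (in_setT _) uz; have [lt _ _ _] := hA _ eA.
rewrite (bigD1 e) //= (_ : (tl e == z)) //; apply: contraTT lt => tz.
by rewrite -leqNgt eu; exact: minu.
Qed.

Lemma tree_connected_branchings n (A : nat -> {set edge G}) (F : {set edge G}) :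
  (forall i, i < n -> A i \subset F) -> (forall i, i < n -> branching hd tl z (A i)) ->
  (forall i j, i < n -> j < n -> i != j -> [disjoint A i & A j]) -> tree_connected n F.
Proof.
move=> AF bA dA; exists (fun i : 'I_n => A i); split=> [i|i|i j ij]; first exact: AF.
  by apply: branching_spanning_tree; exact: bA.
exact: dA.
Qed.

End Trees.

Lemma edge_connected_cut (G : mgraph) k (X : {set vert G}) :
  edge_connected G k -> X != set0 -> X != setT -> k <= cut (@ends G) X.
Proof.
move=> [_ hG] /set0Pn[x xX] XT; rewrite leqNgt; apply/negP => lt.
have [y yX] : exists y, y \notin X.
  by apply/existsP; rewrite -negb_forall; apply: contra XT => /forallP h;
    apply/eqP/setP => y; rewrite inE h.
pose F : {set edge G} := [set e | ((ends e).1 \in X) (+) ((ends e).2 \in X)].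
have cF : #|F| < k.
  apply: leq_ltn_trans lt; rewrite -sum1_card /cut big_mkcond; apply: leq_sum => e _.
  by rewrite inE; case: ifP.
have [_ /(_ x y) con] := hG _ cF.
have cl : closed (adj (~: F)) X.
  move=> u v /exists_inP[e]; rewrite !inE /joins => eF /orP[]/eqP E1; move: eF; rewrite E1 /=;
  by case: (_ \in X); case: (_ \in X).
by have := closed_connect cl con; rewrite xX (negbTE yX).
Qed.

Lemma natr_Z2 n : (n%:R = (odd n)%:R :> 'Z_2)%R.
Proof.
rewrite -{1}(odd_double_half n) -muln2 GRing.natrD GRing.natrM.
by rewrite (_ : 2%:R = 0 :> 'Z_2)%R ?GRing.mulr0 ?GRing.addr0 //; apply/val_inj.
Qed.

Lemma Z2_bool (x : 'Z_2) : (x = (x == 1)%:R)%R.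
Proof. by case: x => -[|[|n]] // h; apply/val_inj. Qed.

(** * A factor with prescribed degree at the root *)

Section Factor.

Variables (m m0 : nat) (G : mgraph) (f : vert G -> bool) (z : vert G).
Hypothesis hG : edge_connected G (2 * (m + m0).+1).
Notation V := (vert G).
Notation E := (edge G).

Lemma deg_setT v : deg [set: E] v = edeg (@ends G) v.
Proof. by apply: eq_bigl => e; rewrite inE. Qed.

Lemma sum_bigcup_branchings n (A : nat -> {set E}) (F : E -> nat) :
  (forall i j, i < n -> j < n -> i != j -> [disjoint A i & A j]) ->
  \sum_(e in \bigcup_(i < n) A i) F e = \sum_(i < n) \sum_(e in A i) F e.
Proof.
by move=> dA; apply: partition_disjoint_bigcup => i j ij; exact: dA.
Qed.

(** Parity at [z] is not controlled here: the degree is [n] up to one unit, and the last clause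
    leaves the decision to the handshake lemma. *)
Lemma parity_factor_root n : (edeg (@ends G) z)./2 <= n + 1 + m0 ->
  n <= uphalf (edeg (@ends G) z) + 1 + m ->
  exists H : {set E},
    [/\ tree_connected m H, tree_connected m0 (~: H),
        forall v, v != z -> odd (deg H v) = f v /\
          (edeg (@ends G) v)./2 <= deg H v + 1 + m0 /\
          deg H v <= uphalf (edeg (@ends G) v) + 1 + m &
        odd n = odd (deg H z) -> deg H z = n].
Proof.
move=> nlo nhi; have V1 : 1 < #|V| by case: hG.
have [b [bX bv bz]] : exists b : E -> bool,
    [/\ forall X : {set V}, X != set0 -> z \notin X -> (m + m0).+1 <= arc_in (@ends G) b X,
        forall v, v != z ->
          (edeg (@ends G) v)./2 <= \sum_e (head_of (@ends G) b e == v) <= uphalf (edeg (@ends G) v) &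
        uphalf (edeg (@ends G) z) <= \sum_e (head_of (@ends G) b e == z)].
  apply: balanced_rooted_orientation => X X0 zX; apply: edge_connected_cut => //.
  by apply: contraNneq zX => ->; rewrite inE.
pose hd := head_of (@ends G) b; pose tl := tail_of (@ends G) b.
have jarc e : joins e (tl e) (hd e).
  by rewrite /joins /tl /hd /tail_of /head_of; case: (b e);
    case: (ends e) => x y; rewrite !eqxx ?orbT.
have degE (F : {set E}) v : deg F v = \sum_(e in F) (hd e == v) + \sum_(e in F) (tl e == v).
  rewrite -big_split; apply: eq_bigr => e _; rewrite /hd /tl /head_of /tail_of.
  by case: (b e) => //; rewrite addnC.
pose ind v := \sum_e (hd e == v); pose outd v := \sum_e (tl e == v).
have edegE v : edeg (@ends G) v = ind v + outd v.
  rewrite -deg_setT degE; congr addn; by apply: eq_bigl => e; rewrite inE.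
have [A [_ bA dA]] : exists A : nat -> {set E},
    [/\ forall i, i < (m + m0).+1 -> A i \subset [set: E],
        forall i, i < (m + m0).+1 -> branching hd tl z (A i) &
        forall i j, i < (m + m0).+1 -> j < (m + m0).+1 -> i != j -> [disjoint A i & A j]].
  apply: disjoint_branchings => X X0 zX; apply: leq_trans (bX X X0 zX) _.
  by rewrite /arc_in /in_arcs [leqRHS](eq_bigl xpredT) // => e; rewrite inE.
pose T := \bigcup_(i < m) A i; pose T0 := \bigcup_(i < m0) A (m + i); pose T1 := A (m + m0).
have bT1 : branching hd tl z T1 by apply: bA.
have inT e : e \in T -> exists2 i, i < m & e \in A i by case/bigcupP => i _ h; exists i.
have inT0 e : e \in T0 -> exists2 i, m <= i < m + m0 & e \in A i.
  by case/bigcupP => i _ h; exists (m + i) => //; rewrite leq_addr ltn_add2l ltn_ord.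
have disj i j e : i < (m + m0).+1 -> j < (m + m0).+1 -> e \in A i -> e \in A j -> i = j.
  move=> li lj ei ej; apply/eqP; apply: contraTT ei => ij.
  by apply/negP => ei; have /pred0P/(_ e) := dA _ _ li lj ij; rewrite /= ei ej.
have dTT0 e : e \in T -> e \notin T0.
  move=> /inT[i im ei]; apply/negP => /inT0[j jm ej].
  have E1 : i = j by apply: disj ei ej; lia.
  by lia.
have dK e : e \in T :|: T0 -> e \notin T1.
  move=> eK; apply/negP => e1; move: eK; rewrite inE.
  by case/orP => [/inT[i im ei]|/inT0[i im ei]]; have : i = m + m0; try lia; apply: disj ei e1; lia.
have sumT (F : E -> nat) : \sum_(e in T) F e = \sum_(i < m) \sum_(e in A i) F e.
  by apply: sum_bigcup_branchings => i j im jm; apply: dA; lia.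
have sumT0 (F : E -> nat) : \sum_(e in T0) F e = \sum_(i < m0) \sum_(e in A (m + i)) F e.
  apply: (@sum_bigcup_branchings m0 (fun i => A (m + i))) => i j im jm ij; apply: dA; lia.
have headT v : \sum_(e in T) (hd e == v) = m * (v != z).
  rewrite sumT (eq_bigr (fun=> (v != z) : nat)) ?sum_nat_const ?card_ord // => i _.
  by apply: (@branching_sum_head G hd tl) => //; apply: bA; have := ltn_ord i; lia.
have headT0 v : \sum_(e in T0) (hd e == v) = m0 * (v != z).
  rewrite sumT0 (eq_bigr (fun=> (v != z) : nat)) ?sum_nat_const ?card_ord // => i _.
  by apply: (@branching_sum_head G hd tl) => //; apply: bA; have := ltn_ord i; lia.
have headT1 v : \sum_(e in T1) (hd e == v) = (v != z).
  exact: (@branching_sum_head G hd tl).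
have tailT : m <= \sum_(e in T) (tl e == z).
  rewrite sumT -[m in m <= _]card_ord -sum1_card; apply: leq_sum => i _.
  by apply: (@branching_root_arc G hd) => //; apply: bA; have := ltn_ord i; lia.
have tailT0 : m0 <= \sum_(e in T0) (tl e == z).
  rewrite sumT0 -[m0 in m0 <= _]card_ord -sum1_card; apply: leq_sum => i _.
  by apply: (@branching_root_arc G hd) => //; apply: bA; have := ltn_ord i; lia.
have tailT1 : 0 < \sum_(e in T1) (tl e == z) by apply: (@branching_root_arc G hd).
have inS (S : {set E}) (F : E -> nat) : \sum_(e in S) F e = \sum_e (e \in S) * F e.
  by rewrite big_mkcond; apply: eq_bigr => e _; case: (e \in S); rewrite ?mul1n.
have [rank [_ hT1 injT1 covT1]] := bT1.
(* A default value, taken by [ev] only at [z]. *)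
have [e0 _] : exists e0 : E, true.
  by case: (pickP (fun e => e \in T1)) => [e _|none]; [exists e | move: tailT1; rewrite big_pred0].
pose ev v := odflt e0 [pick e in T1 | hd e == v].
have evP v : v != z -> ev v \in T1 /\ hd (ev v) = v.
  move=> vz; rewrite /ev; case: pickP => [e /andP[eT1 /eqP]|none] //.
  by have [e eT1 he] := covT1 v (in_setT _) vz; have := none e; rewrite eT1 he eqxx.
have hd_ev v : v != z -> hd (ev v) = v by case/evP.
have stemE : stem hd z ev = T1.
  apply/setP => e; rewrite inE; apply/idP/idP => [/andP[nz /eqP <-]|eT1].
    by case: (evP _ nz).
  have [_ _ _ nz] := hT1 _ eT1; rewrite nz /=.
  by have [h1 h2] := evP _ nz; apply/eqP; exact: injT1.
pose K := T :|: T0; pose B := [set e in K | tl e == z].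
pose c0 e := e \in T.
have headK e : e \in K -> hd e != z.
  rewrite inE => /orP[/inT[i im ei]|/inT0[i im ei]].
    by have [|r [_ h _ _]] := bA i; [lia | have [] := h _ ei].
  by have [|r [_ h _ _]] := bA i; [lia | have [] := h _ ei].
have BK : B \subset K by apply/subsetP => e; rewrite inE => /andP[].
have Kstem e : e \in K -> e \notin stem hd z ev by rewrite stemE; exact: dK.
have excl e : ~~ [|| (e \in T) && (e \in T0), (e \in T) && (e \in T1) | (e \in T0) && (e \in T1)].
  have := dK e; have := dTT0 e; rewrite inE.
  case: (e \in T); case: (e \in T0); case: (e \in T1) => //= h1 h2.
  - by have := h1 isT.
  - by have := h1 isT.
  - by have := h2 isT.
  - by have := h2 isT.
have indE v : ind v = free_in hd z ev K setT v + (m + m0 + 1) * (v != z).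
  rewrite !mulnDl mul1n -headT -headT0 -headT1 /ind /free_in !inS -!big_split.
  apply: eq_bigr => e _; rewrite /= stemE in_setT mul1n.
  move: (excl e); rewrite /K !inE.
  by case: (e \in T); case: (e \in T0); case: (e \in T1); case: (hd e == v).
have outE v : v != z -> free_out B setT tl v = outd v.
  move=> vz; rewrite /free_out /outd !inS; apply: eq_bigr => e _.
  rewrite in_setT mul1n !inE; case: (eqVneq (tl e) v) => [->|] //=.
  by rewrite (negbTE vz) andbF.
have outzE : outd z = \sum_(e in T) (tl e == z) + \sum_(e in T0) (tl e == z) + free_out B setT tl z.
  rewrite /outd /free_out !inS -!big_split; apply: eq_bigr => e _ /=.
  rewrite in_setT mul1n !inE; move: (excl e).
  by case: (e \in T); case: (e \in T0); case: (e \in T1); case: (tl e == z).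
have out_pos : 0 < free_out B setT tl z.
  apply: leq_trans tailT1 _; rewrite /free_out !inS; apply: leq_sum => e _.
  rewrite in_setT mul1n !inE; move: (excl e).
  by case: (e \in T); case: (e \in T0); case: (e \in T1); case: (tl e == z).
have fixT v : v != z -> fixed_in hd K c0 true v = m.
  move=> vz; have := headT v; rewrite vz muln1 => <-; rewrite /fixed_in !inS.
  apply: eq_bigr => e _; rewrite !inE /c0.
  by case: (e \in T); case: (e \in T0); case: (hd e == v).
have fixT0 v : v != z -> fixed_in hd K c0 false v = m0.
  move=> vz; have := headT0 v; rewrite vz muln1 => <-; rewrite /fixed_in !inS.
  apply: eq_bigr => e _; rewrite !inE /c0; move: (excl e).
  by case: (e \in T); case: (e \in T0); case: (e \in T1); case: (hd e == v).
have fixR : fixed_root B c0 = \sum_(e in T) (tl e == z).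
  rewrite /fixed_root !inS; apply: eq_bigr => e _; rewrite !inE /c0.
  by case: (e \in T); case: (e \in T0); case: (tl e == z).
pose a := \sum_(e in T) (tl e == z); pose r := free_out B setT tl z.
(* At [z] exactly one leaving arc outside [B] remains unpaired. *)
pose q v := if v == z then r.-1 else (edeg (@ends G) v)./2 - (m + m0).+1.
(* [j] aims at degree [n], capped by the unpaired entering arcs; as [n <= a + ind z + 1], the cap
   costs at most one unit. *)
pose j := minn (n - (a + q z)) (ind z - q z).
have indz : ind z = free_in hd z ev K setT z by rewrite indE eqxx muln0 addn0.
have halfE v := odd_double_half (edeg (@ends G) v).
(* At most half the degree of [z] is outgoing, including at least [m0] arcs of [T0], whence the
   first bound; at least half is incoming and [m <= a], whence the second. *)
have numz : [/\ a + q z <= n, n <= a + ind z + 1 & q z <= ind z].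
  rewrite /q eqxx; move: nlo nhi bz outzE (edegE z) out_pos tailT tailT0 (halfE z).
  rewrite -/(ind z) -/a -/r uphalf_half; move: (edeg _ z) (\sum_(e in T0) _) => d b'.
  by clear; split; lia.
have [||||v vz|v qv|||c [cf cK cq cz]] :=
    @colouring V E hd z ev hd_ev K B c0 Kstem headK BK setT tl xpred0 q rank j f.
- exact: subsetT.
- exact: subsetT.
- by move=> v vz; have [h1 h2] := evP _ vz; have [] := hT1 _ h1; rewrite h2.
- by move=> e; rewrite inE => /andP[_ /eqP].
- have /andP[lo _] := bv v vz; have := indE v; rewrite /q (negbTE vz) /=.
  by move: lo; rewrite -/(ind v); clear; lia.
- case: (eqVneq v z) qv => [->|vz].
    by rewrite /q eqxx -/r; move: out_pos; rewrite -/r; clear; lia.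
  (* The out-degree is at least the rounded-down half degree, which exceeds a positive [q v]. *)
  have /andP[_ hi] := bv v vz; rewrite outE // /q (negbTE vz).
  move: hi (edegE v) (halfE v); rewrite -/(ind v) uphalf_half; clear; lia.
- by rewrite /q eqxx -/r; move: out_pos; rewrite -/r; clear; lia.
- by rewrite -indz /j; case: numz; clear; lia.
pose H := [set e | c e].
have HE v : deg H v = ends_at hd setT tl xpred0 c v.
  rewrite degE /ends_at -big_split !inS; apply: eq_bigr => e _ /=.
  by rewrite in_setT inE addbF; case: (c e); rewrite ?andbT ?andbF ?mul0n ?mul1n.
have HbE v (b' : bool) :
    deg (if b' then H else ~: H) v = ends_at hd setT tl xpred0 (fun e => c e == b') v.
  rewrite degE /ends_at -big_split !inS; apply: eq_bigr => e _ /=.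
  by case: b'; rewrite in_setT !inE addbF; case: (c e); rewrite ?andbT ?andbF ?mul0n ?mul1n.
have HC v : deg H v + deg (~: H) v = edeg (@ends G) v.
  rewrite -deg_setT !degE !inS -!big_split; apply: eq_bigr => e _ /=.
  by rewrite !inE; case: (c e); rewrite /= ?mul0n ?mul1n ?addn0.
have TH e : e \in T -> e \in H.
  by move=> eT; rewrite inE cK /c0 // inE eT.
have T0H e : e \in T0 -> e \in ~: H.
  move=> eT0; rewrite !inE cK ?inE ?eT0 ?orbT // /c0; apply/negP => /dTT0.
  by rewrite eT0.
exists H; split.
- apply: (tree_connected_branchings (A := A) jarc) => [i im|i im|i i' im im'].
  + by apply/subsetP => e ei; apply: TH; apply/bigcupP; exists (Ordinal im).
  + by apply: bA; lia.
  + by apply: dA; lia.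
- apply: (tree_connected_branchings (A := fun i => A (m + i)) jarc) => [i im|i im|i i' im im' ii'].
  + by apply/subsetP => e ei; apply: T0H; apply/bigcupP; exists (Ordinal im).
  + by apply: bA; lia.
  + by apply: dA; lia.
- move=> v vz; rewrite HE cf //; split=> //; rewrite -HE.
  (* [H] has degree at least [q v + m] and its complement at least [q v + m0]: the lower and the
     upper bound. *)
  have := cq v true vz; have := cq v false vz; rewrite fixT // fixT0 // -!HbE.
  move: (HC v) (halfE v); rewrite /q (negbTE vz) uphalf_half.
  by move: (deg H v) (deg (~: H) v) (edeg _ v) => x y d; clear; lia.
- move: cz; rewrite -HE fixR -/a /j; case: numz.
  by move: (deg H z) (q z) (ind z) => d x y; clear; lia.
Qed.

End Factor.

(** * Parity at the root and conclusion *)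

Import GRing.Theory Num.Theory.
Local Open Scope ring_scope.

Lemma sum_deg_Z2 (G : mgraph) (H : {set edge G}) :
  \sum_(v : vert G) (deg H v)%:R = 0 :> 'Z_2.
Proof.
rewrite -natr_sum /deg exchange_big /= natr_sum big1 // => e _.
rewrite (eq_bigl (fun v => v \in [set: vert G])); last by move=> v; rewrite inE.
by rewrite big_split /= !sum_pred1 !inE; apply/val_inj.
Qed.

Lemma parity_factor_at (m m0 : nat) (G : mgraph) (f : vert G -> 'Z_2) (z : vert G) (n : nat) :
  \sum_(v : vert G) f v = 0 -> edge_connected G (2 * m + 2 * m0 + 2)%N ->
  n%:R = f z ->
  ((deg [set: edge G] z)./2 <= n + 1 + m0)%N ->
  (n <= uphalf (deg [set: edge G] z) + 1 + m)%N ->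
  exists H : {set edge G}, parity_factor m m0 f H /\ deg H z = n.
Proof.
move=> hf hG nz nlo nhi.
have hG' : edge_connected G (2 * (m + m0).+1)%N.
  by have <- : (2 * m + 2 * m0 + 2)%N = (2 * (m + m0).+1)%N by lia.
rewrite deg_setT in nlo nhi.
have [H [TH TH0 Hv Hz]] := parity_factor_root (fun v => f v == 1) hG' nlo nhi.
have par v : v != z -> (deg H v)%:R = f v.
  by move=> /Hv[ov _]; rewrite natr_Z2 ov -Z2_bool.
have parz : (deg H z)%:R = f z.
  (* The parities away from [z] and the handshake lemma force the parity at [z]. *)
  have sumE := etrans (sum_deg_Z2 H) (esym hf); move: sumE.
  rewrite (bigD1 z) //= [RHS](bigD1 z) //= (eq_bigr f) => [h|v /par //].
  exact: (addIr _ h).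
have dz : deg H z = n.
  apply: Hz; move: parz; rewrite -nz natr_Z2 [RHS]natr_Z2.
  by case: (odd n); case: (odd _).
exists H; split=> //; split=> // v.
  by case: (eqVneq v z) => [->|/par].
rewrite deg_setT; case: (eqVneq v z) => [->|/Hv[_ [lo hi]]]; last by clear -lo hi; lia.
by rewrite dz; clear -nlo nhi; lia.
Qed.

Theorem theorem5p5 (m m0 : nat) (G : mgraph) (f : vert G -> 'Z_2)
    (hf : \sum_(v : vert G) f v = 0)
    (hG : edge_connected G (2 * m + 2 * m0 + 2)%N) :
  (exists H : {set edge G}, parity_factor m m0 f H) /\
  (forall (z : vert G) (t : int),
     t%:~R = f z ->
     ((deg [set: edge G] z)./2)%:Z - 1 - m0%:Z <= t
       <= (uphalf (deg [set: edge G] z))%:Z + 1 + m%:Z ->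
     exists H : {set edge G}, parity_factor m m0 f H /\ (deg H z)%:Z = t).
Proof.
split.
  have /card_gt0P[z _] : (0 < #|vert G|)%N by case: hG => /ltnW.
  (* Without a prescribed degree, [lo] and [lo + 1] are both admissible, and one has the parity of
     [f z]. *)
  pose d := deg [set: edge G] z; pose lo := (d./2 - 1 - m0)%N.
  have [n [nz nlo nhi]] : exists n, [/\ n%:R = f z, (lo <= n)%N & (n <= lo + 1)%N].
    case: (eqVneq (odd lo) (f z == 1)) => odd_lo.
      by exists lo; rewrite leqnn leq_addr natr_Z2 odd_lo -Z2_bool.
    exists (lo + 1)%N; rewrite leqnn leq_addr natr_Z2 (Z2_bool (f z)) oddD.
    by split=> //; move: odd_lo; case: (odd lo); case: (_ == 1).
  have [||H [PH _]] := parity_factor_at hf hG nz; last by exists H.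
    by move: nlo; rewrite /lo -/d; clear; lia.
  by move: nhi; rewrite /lo -/d uphalf_half; clear; lia.
move=> z t tz /andP[tlo thi].
(* The degree of [z] is at least its cut, so the lower bound on [t] is nonnegative and negative
   integers drop out. *)
have deg_z : (2 * m + 2 * m0 + 2 <= deg [set: edge G] z)%N.
  rewrite deg_setT -(big_set1 (addn : Monoid.law 0%N) z (edeg _)) sum_edeg.
  apply: leq_trans (leq_addl _ _); apply: edge_connected_cut => //.
    by apply/set0Pn; exists z; rewrite inE.
  case: hG => V1 _; apply: contraTneq V1 => zT.
  by rewrite -cardsT -zT cards1.
case: t tz tlo thi => n tz tlo thi; last by move: tlo deg_z; clear; lia.
have [||H [PH <-]] := parity_factor_at hf hG tz; last by exists H.
  by move: tlo; clear; lia.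
by move: thi; clear; lia.
Qed.
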